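(* Let $S=(G,\mathbf{P},\Lambda,I)$ be a finite simple semigroup. Then $S$ is an equational domain in the language $\mathcal{L}_S$ if and only if the following two conditions hold: 1. the matrix $\mathbf{P}$ is nonsingular; 2. $G$ is an equational domain in the group language $\mathcal{L}_G$.
   Context: A semigroup is simple if it has no (two-sided) ideal other than itself. By the Sushkevich–Rees theorem every finite simple semigroup is, up to isomorphism, of the form $S=(G,\mathbf{P},\Lambda,I)$, where $G$ is a finite group, $\Lambda$ and $I$ are finite nonempty index sets $\{1,\dots,|\Lambda|\}$ and $\{1,\dots,|I|\}$, and $\mathbf{P}=(p_{i\lambda})_{i\in I,\lambda\in\Lambda}$ is a matrix over $G$ with $|I|$ rows and $|\Lambda|$ columns which is normalized, i.e. all elements of its first row and first column equal $1\in G$ ($p_{1\lambda}=p_{i1}=1$). The elements of $S$ are the triples $(\lambda,g,i)$ with $\lambda\in\Lambda$, $g\in G$, $i\in I$, and the multiplication is $(\lambda,g,i)(\mu,h,j)=(\lambda,g\,p_{i\mu}h,j)$. The matrix $\mathbf{P}$ is nonsingular if it does not contain two equal rows or two equal columns (at different indices). Semigroups: for a semigroup $S$, an $\mathcal{L}_S$-term in variables $x_1,\dots,x_n$ is a finite nonempty product of variables and constants from $S$. An equation over $\mathcal{L}_S$ is an equality of two $\mathcal{L}_S$-terms; a system is an arbitrary set of equations. A set $Y\subseteq S^n$ is algebraic over $\mathcal{L}_S$ if it is the set of all solutions in $S^n$ of some system over $\mathcal{L}_S$ in variables $x_1,\dots,x_n$. $S$ is an equational domain in $\mathcal{L}_S$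 if for any $n$ and any finite collection of algebraic sets $Y_1,\dots,Y_k\subseteq S^n$ ($k\ge 1$) over $\mathcal{L}_S$ the union $Y_1\cup\dots\cup Y_k$ is algebraic over $\mathcal{L}_S$. Groups: for a group $G$, $\mathcal{L}_G=\{\cdot,{}^{-1},1\}\cup\{g\mid g\in G\}$; an $\mathcal{L}_G$-term in $x_1,\dots,x_n$ is an element of the free product $F(x_1,\dots,x_n)\ast G$ (a product of integer powers of variables and constants of $G$). Equations, systems, algebraic sets, and equational domains in the language $\mathcal{L}_G$ are defined in the same way using $\mathcal{L}_G$-terms. *)

(* Defs.v *)
From HB Require Import structures.
From mathcomp Require Import all_boot all_order all_algebra all_fingroup.
From mathcomp Require Import classical_sets.

Set Implicit Arguments.
Unset Strict Implicit.
Unset Printing Implicit Defensive.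

Local Open Scope group_scope.
Local Open Scope classical_set_scope.

Section Algebraic.
(* [term n] is the type of terms in the variables x_0, ..., x_(n-1) and
   [eval x t] is the value of t at the point x of S^n. An equation is a pair of
   terms and a system is an arbitrary, possibly infinite or empty, set of them. *)
Variables (S : Type) (term : nat -> Type).
Variable eval : forall n, n.-tuple S -> term n -> S.

Definition solutions n (E : set (term n * term n)) : set (n.-tuple S) :=
  [set x | forall e, E e -> eval x e.1 = eval x e.2].

Definition algebraic n (Y : set (n.-tuple S)) : Prop :=
  exists E : set (term n * term n), Y = solutions E.

Definition equational_domain : Prop :=
  forall (n k : nat) (Y : 'I_k -> set (n.-tuple S)),
    (0 < k)%N -> (forall j, algebraic (Y j)) ->
    algebraic (\bigcup_(j in [set: 'I_k]) Y j).

End Algebraic.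

Section SemigroupTerms.
Variable S : semigroupType.

Inductive sg_letter (n : nat) : Type :=
| SgVar of 'I_n
| SgConst of S.

(* A nonempty product, given by its first factor and the remaining ones. *)
Definition sg_term (n : nat) : Type := (sg_letter n * seq (sg_letter n))%type.

Definition sg_letter_eval n (x : n.-tuple S) (a : sg_letter n) : S :=
  match a with SgVar i => tnth x i | SgConst s => s end.

Definition sg_eval n (x : n.-tuple S) (t : sg_term n) : S :=
  foldl (fun s a => s * sg_letter_eval x a) (sg_letter_eval x t.1) t.2.

Definition sg_equational_domain : Prop := equational_domain sg_eval.

Definition sg_ideal (A : set S) : Prop :=
  A !=set0 /\ forall s a : S, A a -> A (s * a) /\ A (a * s).

Definition sg_simple : Prop := forall A : set S, sg_ideal A -> A = setT.

End SemigroupTerms.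

Section GroupTerms.
Variable G : groupType.

Inductive gr_letter (n : nat) : Type :=
| GrPow of 'I_n & int
| GrConst of G.

(* A word represents an element of the free product F(x_0, ..., x_(n-1)) * G.
   Words need not be reduced: the value at a point of G^n depends only on the
   element represented. *)
Definition gr_term (n : nat) : Type := seq (gr_letter n).

Definition expgi (g : G) (z : int) : G :=
  match z with Posz k => g ^+ k | Negz k => g ^- k.+1 end.

Definition gr_letter_eval n (x : n.-tuple G) (a : gr_letter n) : G :=
  match a with GrPow i z => expgi (tnth x i) z | GrConst g => g end.

Definition gr_eval n (x : n.-tuple G) (t : gr_term n) : G :=
  \prod_(a <- t) gr_letter_eval x a.

Definition gr_equational_domain : Prop := equational_domain gr_eval.

End GroupTerms.

Section Rees.
(* The index sets are I = 'I_m.+1 (rows of P) and Lambda = 'I_l.+1 (columns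
   of P); the distinguished first index is ord0. *)
Variables (gT : finGroupType) (m l : nat).
Implicit Type P : 'M[gT]_(m.+1, l.+1).

Definition normalized P : Prop :=
  (forall mu, P ord0 mu = 1) /\ (forall i, P i ord0 = 1).

Definition nonsingular P : Prop :=
  (forall i j, i != j -> row i P != row j P) /\
  (forall la mu, la != mu -> col la P != col mu P).

Record rees P := Rees { rees_la : 'I_l.+1; rees_g : gT; rees_i : 'I_m.+1 }.

Section Structure.
Variable P : 'M[gT]_(m.+1, l.+1).

Definition rees_triple (s : rees P) : 'I_l.+1 * gT * 'I_m.+1 :=
  (rees_la s, rees_g s, rees_i s).
Definition triple_rees (u : 'I_l.+1 * gT * 'I_m.+1) : rees P :=
  Rees P u.1.1 u.1.2 u.2.

Lemma rees_tripleK : cancel rees_triple triple_rees.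
Proof. by case. Qed.

HB.instance Definition _ := Finite.copy (rees P) (can_type rees_tripleK).

Definition rees_mul (s t : rees P) : rees P :=
  Rees P (rees_la s) (rees_g s * P (rees_i s) (rees_la t) * rees_g t)
         (rees_i t).

Lemma rees_mulA : associative rees_mul.
Proof. by move=> [la g i] [mu h j] [nu k r]; rewrite /rees_mul /= !mulgA. Qed.

HB.instance Definition _ := isSemigroup.Build (rees P) rees_mulA.

Lemma rees_simple : sg_simple (rees P).
Proof.
move=> A [[[mu h j] Ah] Aid]; apply/seteqP; split=> // -[la g i] _.
pose s := Rees P la (g * (P ord0 mu * h * P j ord0)^-1) ord0.
have -> : Rees P la g i = s * Rees P mu h j * Rees P ord0 1 i.
  by congr Rees; rewrite /= mulg1 -(mulgA _ (P ord0 mu)) -(mulgA _ (_ * h)) mulgVK.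
exact: (Aid _ _ (Aid s _ Ah).1).2.
Qed.

End Structure.
End Rees.

(* Main.v *)
Require Import Defs.
From mathcomp Require Import all_boot all_order all_algebra all_fingroup.
From mathcomp Require Import cyclic.
From mathcomp Require Import boolp classical_sets.

(** A set Y is algebraic exactly when every point q outside Y is excluded by one
    equation that holds on Y and fails at q, so all three implications reduce to
    producing or refuting a single equation. The link between S and G is the
    corner: since P is normalized, g |-> (0, g, 0) is an isomorphism of G onto the
    subsemigroup e * S * e with e = (0, 1, 0), where 0 is the first index.

    If P has two equal rows i and j, the elements (0, 1, i) and (0, 1, j) are
    twins: replacing one by the other inside a product changes nothing except
    the last index, and that index is decided by the last letter of the product
    alone. A one-letter observation cannot express a disjunction, so the union of
    x_0 = s and x_1 = s is not algebraic ([twins_not_equational_domain]). Equal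
    columns are treated in the same way through first letters.

    If S is an equational domain, then so is G ([group_equational_domain]): a
    group word is a semigroup term at corner points, inverses being positive
    powers in a finite group ([term_function_corner_word]); conversely the value
    of a semigroup term at corner points is a group word between two fixed
    indices ([eval_at_corner]). Unions therefore transfer from S to G.

    Finally let P be nonsingular and G an equational domain
    ([semigroup_equational_domain]). Distinct a and b in S are kept apart by some
    map x |-> u * x * v into the corner ([nonsingular_separates]). At a point q
    outside Y_0, ..., Y_(k-1), this turns an equation of Y_j that fails at q into
    a function z_j with values in G, computed by a term, which equals 1 on Y_j
    but not at q. Since the union of the hyperplanes y_j = 1 is algebraic in G^k,
    some group equation holds on it and fails at (z_0(q), ..., z_(k-1)(q));
    substituting the z_j gives the equation over S that excludes q. *)

Set Implicit Arguments.
Unset Strict Implicit.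
Unset Printing Implicit Defensive.

Local Open Scope group_scope.
Local Open Scope classical_set_scope.

(** * Algebraic sets as separated sets *)

Section Separation.
Variables (S : Type) (term : nat -> Type).
Variable eval : forall n, n.-tuple S -> term n -> S.

Definition separates n (Y : set (n.-tuple S)) (q : n.-tuple S)
    (e : term n * term n) : Prop :=
  (forall x, Y x -> eval x e.1 = eval x e.2) /\ eval q e.1 <> eval q e.2.

Lemma algebraic_separated n (Y : set (n.-tuple S)) :
  algebraic eval Y <-> forall q, ~ Y q -> exists e, separates Y q e.
Proof.
split=> [[E ->] q /existsNP[e /not_implyP[Ee neq]]|sepY].
  by exists e; split=> // x; apply.
exists [set e | forall x, Y x -> eval x e.1 = eval x e.2].
apply/seteqP; split=> [x Yx e|q Eq]; first exact.
by apply: contrapT => /sepY[e [Ye]]; apply; exact: Eq.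
Qed.

End Separation.

(** * Functions computed by semigroup terms *)

Section SemigroupTermFunctions.
Variables (S : semigroupType) (n : nat).

(** Working with functions instead of terms turns the substitution of terms into
    words into a plain composition of functions. *)
Definition term_function (f : n.-tuple S -> S) : Prop :=
  exists t : sg_term S n, forall x, sg_eval x t = f x.

Lemma term_function_const s : term_function (fun=> s).
Proof. by exists (SgConst n s, [::]). Qed.

Lemma term_function_var i : term_function (fun x => tnth x i).
Proof. by exists (SgVar S i, [::]). Qed.

Lemma term_function_eval t : term_function (fun x => sg_eval x t).
Proof. by exists t. Qed.

Lemma term_function_mul f g :
  term_function f -> term_function g -> term_function (fun x => f x * g x).
Proof.
move=> [[a s] fE] [[b t] gE]; exists (a, s ++ b :: t) => x.
rewrite -fE -gE /sg_eval foldl_cat /=.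
elim/last_ind: t {gE} => //= t c IHt.
by rewrite -!cats1 !foldl_cat /= IHt mulgA.
Qed.

Lemma separates_term_function (Y : set (n.-tuple S)) q f g :
  term_function f -> term_function g ->
  (forall x, Y x -> f x = g x) -> f q <> g q ->
  exists e, separates (@sg_eval S) Y q e.
Proof.
move=> [t fE] [r gE] Yfg qfg; exists (t, r).
by split=> /= [x Yx|]; rewrite fE gE //; exact: Yfg.
Qed.

End SemigroupTermFunctions.

(** * Twin elements obstruct unions *)

Section Twins.
(** The pair ([core], [tip]) splits an element of S: [core] is a congruence, and
    the tip of a product is the tip of one extreme factor. For a Rees semigroup
    the tip is either the row index (last factor) or the column index (first
    factor), and the core keeps the row or column of P in place of that index. *)
Variables (S : semigroupType) (A B : Type) (core : S -> A) (tip : S -> B).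
Variable ending : forall n, sg_term S n -> sg_letter S n.
Hypothesis core_tip_inj : forall u v, core u = core v -> tip u = tip v -> u = v.
Hypothesis core_mul : forall u u' v v',
  core u = core u' -> core v = core v' -> core (u * v) = core (u' * v').
Hypothesis tip_ending : forall n (x : n.-tuple S) (t : sg_term S n),
  tip (sg_eval x t) = tip (sg_letter_eval x (ending t)).

Lemma core_eval n (x y : n.-tuple S) t :
  (forall i, core (tnth x i) = core (tnth y i)) ->
  core (sg_eval x t) = core (sg_eval y t).
Proof.
move=> xy; case: t => a t; rewrite /sg_eval /=.
have core_letter b : core (sg_letter_eval x b) = core (sg_letter_eval y b).
  by case: b => /=.
elim/last_ind: t => [|t b IHt]; first exact: core_letter.
by rewrite -cats1 !foldl_cat /=; apply: core_mul.
Qed.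

(** In the union of x_0 = s and x_1 = s the points with one coordinate s and the
    other s' already force the two sides of an equation to have the same kind of
    ending: the same variable, or two constants with the same tip. The two tips
    then agree at (s', s') too, and so do the two cores, which cannot tell that
    point from one in the union; yet (s', s') lies outside the union. *)
Lemma twins_not_equational_domain s s' :
  core s = core s' -> tip s <> tip s' -> ~ sg_equational_domain S.
Proof.
move=> cs ts dom.
pose Y (j : 'I_2) := [set x : 2.-tuple S | tnth x j = s].
have algY j : algebraic (@sg_eval S) (Y j).
  apply/algebraic_separated => q qj.
  apply: (separates_term_function (f := fun x => tnth x j) (g := fun=> s)) => //.
  - exact: term_function_var.
  - exact: term_function_const.
have /algebraic_separated sep := dom _ _ Y isT algY.
pose spike (j : 'I_2) := [tuple if i == j then s else s' | i < 2].
have YU j : (\bigcup_(j in [set: 'I_2]) Y j) (spike j).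
  by exists j; rewrite // /Y /= tnth_mktuple eqxx.
have [[j _]|[t r] [/= Ytr]] := sep [tuple s' | _ < 2].
  by rewrite /Y /= tnth_mktuple => ss'; apply: ts; rewrite ss'.
move=> neq; apply: neq; apply: core_tip_inj.
  have twin u : core (sg_eval [tuple s' | _ < 2] u) = core (sg_eval (spike ord0) u).
    by apply: core_eval => i; rewrite !tnth_mktuple; case: ifP.
  by rewrite !twin (Ytr _ (YU ord0)).
(* An ending x_c takes the tip of s at one of the two points and the tip of s'
   at the other, which a constant or the other variable cannot match. *)
have var_ending a b c :
    (forall j, tip (sg_letter_eval (spike j) a) = tip (sg_letter_eval (spike j) b)) ->
    a = SgVar S c -> b = SgVar S c.
  move=> /[swap] ->{a} ab.
  have [d dc] : exists d : 'I_2, d != c by exists (rev_ord c); case: c {ab} => -[|[]].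
  have := ab c; have := ab d.
  rewrite /= !tnth_mktuple eqxx eq_sym (negPf dc).
  case: b {ab} => [b|v] /=; last by move=> <-.
  rewrite !tnth_mktuple; case: (eqVneq b c) => [->//|_] _ ts'.
  by case: ts.
have endtr j : tip (sg_letter_eval (spike j) (ending t)) =
               tip (sg_letter_eval (spike j) (ending r)).
  by rewrite -!tip_ending (Ytr _ (YU j)).
rewrite !tip_ending.
case Et: (ending t) => [a|u]; first by rewrite (var_ending _ _ _ endtr Et).
case Er: (ending r) => [b|v]; last by have := endtr ord0; rewrite Et Er.
by rewrite (var_ending _ _ b (fun j => esym (endtr j)) Er) in Et.
Qed.

End Twins.

(** * The corner of a Rees matrix semigroup *)

Section ReesSemigroup.
Variables (gT : finGroupType) (m l : nat) (P : 'M[gT]_(m.+1, l.+1)).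

Lemma rees_ext (u v : rees P) :
  rees_la u = rees_la v -> rees_g u = rees_g v -> rees_i u = rees_i v -> u = v.
Proof. by case: u v => [la g i] [mu h j] /= -> -> ->. Qed.

Lemma rees_i_last n (x : n.-tuple (rees P)) t :
  rees_i (sg_eval x t) = rees_i (sg_letter_eval x (last t.1 t.2)).
Proof.
case: t => a t; rewrite /sg_eval /=; elim/last_ind: t => //= t b _.
by rewrite -cats1 foldl_cat last_cat.
Qed.

Lemma rees_la_head n (x : n.-tuple (rees P)) t :
  rees_la (sg_eval x t) = rees_la (sg_letter_eval x t.1).
Proof.
case: t => a t; rewrite /sg_eval /=; elim/last_ind: t => //= t b IHt.
by rewrite -cats1 foldl_cat.
Qed.

Lemma equational_domain_nonsingular :
  sg_equational_domain (rees P) -> nonsingular P.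
Proof.
move=> dom; split=> [i j neq|la mu neq]; apply/eqP => eqP0; move: dom.
- apply: (@twins_not_equational_domain _ _ _
    (fun u : rees P => (rees_la u, rees_g u, row (rees_i u) P)) (@rees_i _ _ _ P)
    (fun n t => last t.1 t.2) _ _ _ (Rees P ord0 1 i) (Rees P ord0 1 j)).
  + by move=> u v [] *; apply: rees_ext.
  + move=> u u' v v' [la_u g_u /rowP row_u] [la_v g_v row_v] /=.
    rewrite /= la_u g_u la_v g_v row_v.
    by have := row_u (rees_la v'); rewrite !mxE => ->.
  + by move=> n x t; exact: rees_i_last.
  + by rewrite /= eqP0.
  + exact/eqP.
- apply: (@twins_not_equational_domain _ _ _
    (fun u : rees P => (col (rees_la u) P, rees_g u, rees_i u)) (@rees_la _ _ _ P)
    (fun n t => t.1) _ _ _ (Rees P la 1 ord0) (Rees P mu 1 ord0)).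
  + by move=> u v [] *; apply: rees_ext.
  + move=> u u' v v' [col_u g_u i_u] [/colP col_v g_v i_v].
    rewrite /= col_u g_u i_u g_v i_v.
    by have := col_v (rees_i u'); rewrite !mxE => ->.
  + by move=> n x t; exact: rees_la_head.
  + by rewrite /= eqP0.
  + exact/eqP.
Qed.

Hypothesis hP : normalized P.

Definition corner (g : gT) : rees P := Rees P ord0 g ord0.

Lemma corner_inj : injective corner.
Proof. by move=> g h []. Qed.

Lemma cornerM g h : corner (g * h) = corner g * corner h.
Proof. by apply: rees_ext; rewrite //= hP.1 mulg1. Qed.

(** This makes the group coordinate of a variable, read in the corner, the value
    of a semigroup term. *)
Lemma corner_project u : corner 1 * u * corner 1 = corner (rees_g u).
Proof. by apply: rees_ext; rewrite //= hP.1 hP.2 !(mulg1, mul1g). Qed.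

Section CornerTermFunctions.
Variable n : nat.
Implicit Type f : n.-tuple (rees P) -> gT.

Lemma term_function_cornerX f k :
  term_function (corner \o f) -> term_function (fun x => corner (f x ^+ k)).
Proof.
move=> tf; elim: k => [|k IHk]; first exact: (term_function_const n (corner 1)).
have [t tE] := term_function_mul tf IHk.
by exists t => x; rewrite tE expgS cornerM.
Qed.

(** Semigroup terms have no inverse, but in a finite group g^-1 is the power
    g ^+ (#|G| - 1). *)
Lemma term_function_cornerV f :
  term_function (corner \o f) -> term_function (fun x => corner (f x)^-1).
Proof.
move=> /(@term_function_cornerX _ #|[set: gT]%SET|.-1)[t tE]; exists t => x.
rewrite tE; congr corner; apply/esym/eqP; rewrite eq_invg_mul -expgS.
by rewrite prednK ?cardG_gt0 // expg_cardG ?inE.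
Qed.

Lemma term_function_corner_word p (f : 'I_p -> n.-tuple (rees P) -> gT)
    (w : gr_term gT p) :
  (forall i, term_function (corner \o f i)) ->
  term_function (fun x => corner (gr_eval [tuple f i x | i < p] w)).
Proof.
move=> tf; elim: w => [|a w IHw].
  by exists (SgConst n (corner 1), [::]) => x; rewrite /gr_eval big_nil.
suff ta : term_function
    (fun x => corner (gr_letter_eval [tuple f i x | i < p] a)).
  have [t tE] := term_function_mul ta IHw.
  by exists t => x; rewrite tE /gr_eval big_cons cornerM.
case: a => [i z|g]; last exact: (term_function_const n (corner g)).
have [t tE] : term_function (fun x => corner (expgi (f i x) z)).
  case: z => k /=; first exact: term_function_cornerX.
  by apply: term_function_cornerV; exact: term_function_cornerX.
by exists t => x; rewrite tE /= tnth_mktuple.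
Qed.

End CornerTermFunctions.

(** The outer indices do not depend on the point, because corner points all have
    the same indices; the entries of P between consecutive letters become
    constants of the group word. *)
Lemma eval_at_corner n (t : sg_term (rees P) n) :
  exists la (w : gr_term gT n) i, forall y : n.-tuple gT,
    sg_eval (map_tuple corner y) t = Rees P la (gr_eval y w) i.
Proof.
have letterE (a : sg_letter (rees P) n) : exists la (w : gr_term gT n) i,
    forall y : n.-tuple gT,
    sg_letter_eval (map_tuple corner y) a = Rees P la (gr_eval y w) i.
  case: a => [j|[la g i]].
    exists ord0, [:: GrPow gT j 1%Z], ord0 => y.
    by rewrite /= tnth_map /gr_eval big_seq1.
  by exists la, [:: GrConst n g], i => y; rewrite /gr_eval big_seq1.
case: t => a t; rewrite /sg_eval /=; elim/last_ind: t => [|t b]; first exact: letterE.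
have [mu [v [j bE]]] := letterE b; move=> [la [w [i tE]]].
exists la, (w ++ GrConst n (P i mu) :: v), j => y.
rewrite -cats1 foldl_cat /= bE tE /gr_eval big_cat big_cons.
by apply: rees_ext => //=; rewrite mulgA.
Qed.

(** Each Y j is carried to its image Z j in S^n, which is algebraic: the equations
    e * x_i * e = x_i cut out the corner points, and group equations are read as
    semigroup equations there. *)
Lemma group_equational_domain :
  sg_equational_domain (rees P) -> gr_equational_domain gT.
Proof.
move=> dom n k Y k0 algY.
(* A point p of the union guarantees that the two sides of each equation below
   have equal outer indices. The empty union needs no equation: it is one of
   the Y j, and G may be trivial, in which case every equation is solvable. *)
have [[p Yp]|Y0] := pselect (exists p, (\bigcup_(j in [set: 'I_k]) Y j) p); last first.
  suff -> : \bigcup_(j in [set: 'I_k]) Y j = Y (Ordinal k0) by [].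
  apply/seteqP; split=> [x Yx|x Yx]; first by case: Y0; exists x.
  by exists (Ordinal k0).
pose Z (j : 'I_k) := [set map_tuple corner y | y in Y j].
have term_g i : term_function (corner \o (fun x : n.-tuple (rees P) => rees_g (tnth x i))).
  have [t tE] := term_function_mul (term_function_mul
    (term_function_const n (corner 1)) (term_function_var _ i))
    (term_function_const n (corner 1)).
  by exists t => x; rewrite tE corner_project.
have algZ j : algebraic (@sg_eval (rees P)) (Z j).
  apply/algebraic_separated => q nZq.
  have [[i qi]|qcorner] :=
    pselect (exists i, corner (rees_g (tnth q i)) <> tnth q i).
    apply: (separates_term_function (term_g i) (term_function_var _ i)) => //.
    by move=> _ [y _ <-] /=; rewrite tnth_map.
  have {}qcorner : map_tuple corner [tuple rees_g (tnth q i) | i < n] = q.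
    apply: eq_from_tnth => i; rewrite tnth_map tnth_mktuple.
    by apply: contrapT => qi; apply: qcorner; exists i.
  have /algebraic_separated sepY := algY j.
  have [|[w w'] [/= Yww' qww']] := sepY [tuple rees_g (tnth q i) | i < n].
    by move=> Yq; apply: nZq; exists [tuple rees_g (tnth q i) | i < n].
  apply: (separates_term_function (term_function_corner_word w term_g)
    (term_function_corner_word w' term_g)) => [_ [y Yy <-]|/corner_inj//].
  suff -> : [tuple rees_g (tnth (map_tuple corner y) i) | i < n] = y.
    by rewrite (Yww' _ Yy).
  by apply: eq_from_tnth => i; rewrite tnth_mktuple tnth_map.
have /algebraic_separated sepZ := dom _ _ Z k0 algZ.
have ZU y : (\bigcup_(j in [set: 'I_k]) Y j) y ->
    (\bigcup_(j in [set: 'I_k]) Z j) (map_tuple corner y).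
  by move=> [j _ Yjy]; exists j => //; exists y.
apply/algebraic_separated => q nYq.
have [|[t r] [/= Ztr]] := sepZ (map_tuple corner q).
  move=> [j _ [y Yjy /(congr1 (@tval _ _))/(inj_map corner_inj)/val_inj yq]].
  by apply: nYq; exists j; rewrite // -yq.
have [la [w [i tE]]] := eval_at_corner t.
have [mu [v [j rE]]] := eval_at_corner r.
have := Ztr _ (ZU _ Yp); rewrite !tE !rE => -[-> _ ->] qwv.
exists (w, v); split=> /= [y Yy|wv]; last by apply: qwv; rewrite wv.
by have := Ztr _ (ZU _ Yy); rewrite tE rE => -[].
Qed.

(** If no such u and v exist, then P i la * g * P j mu takes equal values at
    a = (la, g, j) and at b for all i and mu. The normalized entries give equal
    group coordinates, and then mu = 0 gives equal columns of P and i = 0 equal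
    rows. *)
Lemma nonsingular_separates (a b : rees P) : nonsingular P -> a <> b ->
  exists u v : rees P, [/\ rees_la u = ord0, rees_i v = ord0 &
    rees_g (u * a * v) <> rees_g (u * b * v)].
Proof.
move=> [row_inj col_inj] ab; apply: contrapT => nsep.
have abE i mu : P i (rees_la a) * rees_g a * P (rees_i a) mu =
                P i (rees_la b) * rees_g b * P (rees_i b) mu.
  apply: contrapT => abi; apply: nsep.
  exists (Rees P ord0 1 i), (Rees P mu 1 ord0); split=> //=.
  by rewrite !mul1g !mulg1.
apply: ab.
have gE : rees_g a = rees_g b.
  by have := abE ord0 ord0; rewrite !hP.1 !hP.2 !mul1g !mulg1.
apply: rees_ext => //; apply/eqP; apply: contraT.
- move=> /col_inj/eqP[]; apply/colP => i; rewrite !mxE.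
  by have := abE i ord0; rewrite gE !hP.2 !mulg1 => /mulIg.
- move=> /row_inj/eqP[]; apply/rowP => mu; rewrite !mxE.
  by have := abE ord0 mu; rewrite gE !hP.1 !mul1g => /mulgI.
Qed.

(** The n variables over S are traded for k variables over G, one for each set:
    the point (z_0(x), ..., z_(k-1)(x)) of G^k lies on the j-th hyperplane
    y_j = 1 for x in Y j, and on none of them for x = q. *)
Lemma semigroup_equational_domain :
  nonsingular P -> gr_equational_domain gT -> sg_equational_domain (rees P).
Proof.
move=> nsP dom n k Y k0 algY; apply/algebraic_separated => q nYq.
have sep_j j : exists z : n.-tuple (rees P) -> gT,
    [/\ term_function (corner \o z), forall x, Y j x -> z x = 1 & z q <> 1].
  have /algebraic_separated sepY := algY j.
  have [Yq|[t r] [/= Ytr qtr]] := sepY q; first by apply: nYq; exists j.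
  have [u [v [ula vi uv]]] := nonsingular_separates nsP qtr.
  pose f (s : sg_term (rees P) n) x := rees_g (u * sg_eval x s * v).
  have tf s : term_function (corner \o f s).
    have [s' s'E] := term_function_mul (term_function_mul
      (term_function_const n u) (term_function_eval s)) (term_function_const n v).
    by exists s' => x; rewrite s'E; apply: rees_ext.
  exists (fun x => f t x * (f r x)^-1); split.
  - have [s sE] := term_function_mul (tf t) (term_function_cornerV (tf r)).
    by exists s => x; rewrite sE /= cornerM.
  - by move=> x Yx; rewrite /f (Ytr _ Yx) mulgV.
  - by move=> /eqP; rewrite -eq_mulgV1 => /eqP.
have [z /all_and3[tz Yz qz]] := fin_all_exists sep_j.
pose H (j : 'I_k) := [set y : k.-tuple gT | tnth y j = 1].
have algH j : algebraic (@gr_eval gT) (H j).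
  exists [set ([:: GrPow gT j 1%Z], [::])].
  apply/seteqP; split=> [y Hy _ -> /=|y /(_ _ erefl) /=];
    by rewrite /gr_eval big_seq1 big_nil.
have /algebraic_separated sepH := dom _ _ H k0 algH.
have [|[w w'] [/= Hww' qww']] := sepH [tuple z j q | j < k].
  by move=> [j _]; rewrite /H /= tnth_mktuple => /qz.
apply: (separates_term_function (term_function_corner_word w tz)
  (term_function_corner_word w' tz)) => [x [j _ Yjx]|/corner_inj//].
rewrite Hww' //; exists j => //.
by rewrite /H /= tnth_mktuple Yz.
Qed.

End ReesSemigroup.

Theorem theorem4p8 (gT : finGroupType) (m l : nat)
    (P : 'M[gT]_(m.+1, l.+1)) (hP : normalized P) :
  sg_equational_domain (rees P) <->
  nonsingular P /\ gr_equational_domain gT.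
Proof.
split=> [dom|[nsP domG]]; last exact: semigroup_equational_domain.
split; first exact: equational_domain_nonsingular.
exact: group_equational_domain dom.
Qed.
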